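(* With the time scale $\mathbb{T}$, the weights $\rho_k$, the functions $A_k,B_k,\eta_k,g_k,h_k,f_k,\varphi_k$, the Hilbert spaces $\mathcal{H}_k=L^2(\mathbb{T},\rho_k\mu_\Delta)$ and the operators $\mathcal{A}_k=h_k\Delta+f_kI_k:\mathcal{H}_k\to\mathcal{H}_{k+1}$ as in the context, and with constants $a_k,b_k\in\mathbb{R}$, $a_k\neq0$, the equation $$\mathcal{A}_k\mathcal{A}_k^*=a_k\,\mathcal{A}_{k+1}^*\mathcal{A}_{k+1}+b_k\qquad\text{for all }k$$ is equivalent to the following set of relations $$h_{k+1}\,\varphi_{k+1}=\frac1{a_k}\,\frac{h_k\,\varphi_k^{\sigma}}{g_k^{\sigma}},$$ $$a_k\,g_k\left(\frac{B_k\,\big(h_{k+1}^{\sigma^{-1}}\big)^2}{\mu\,\mu^{\sigma^{-1}}}-\frac1{a_k}\frac{\varphi_k^2\,\eta_k}{g_k}\right)+b_k=\frac{B_k^{\sigma}\,h_k^2}{\mu^{\sigma}\,\mu}-\frac1{a_k}\,\frac{(\varphi_k^{\sigma})^2\,\eta_k^{\sigma}}{g_k^{\sigma}}\,\frac{h_k^2}{h_{k+1}^2}$$ on the functions $B_k$, $\eta_k$, $\varphi_k$, $g_k$, $h_k$, $h_{k+1}$ and constants $a_k$, $b_k$, for all $k$.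
   Context: **Time scale.** $\mathbb{T}$ is a closed subset of $\mathbb{R}$ in which every point is isolated (excluding $\max\mathbb{T}$ and $\min\mathbb{T}$ if they exist, which are assumed to be only one-side scattered). Put $\sigma(x)=\inf\{t\in\mathbb{T}: t>x\}$ with $\inf\emptyset:=\max\mathbb{T}$, and $\mu(x)=\sigma(x)-x$. For a set $X$, $X^\kappa$ (resp. $X_\kappa$) denotes $X$ with its maximal (resp. minimal) point removed, or $X$ itself if there is no such point; $\mathbb{T}^{\kappa\kappa}=(\mathbb{T}^\kappa)^\kappa$ and $\mathbb{T}^\kappa_\kappa=(\mathbb{T}^\kappa)_\kappa$. Thus $\sigma(x)\neq x$ for $x\in\mathbb{T}^\kappa$. The $\Delta$-derivative on $\mathbb{T}^\kappa$ is $f^\Delta=(f\circ\sigma-f)/\mu$. **Shift notation.** $f^{\sigma}(x):=f(\sigma(x))\,\chi_{\mathbb{T}^{\kappa\kappa}}(x)$ and $f^{\sigma^{-1}}(x):=f(\sigma^{-1}(x))\,\chi_{\mathbb{T}^\kappa_\kappa}(x)$, where $\chi_A$ is the characteristic function of $A$. **Weights and structural functions.** The index $k$ runs over $\mathbb{N}\cup\{0\}$. The weight functions $\rho_k:\mathbb{T}^\kappa\to\mathbb{R}_+\cup\{0\}$ and functions $A_k,B_k:\mathbb{T}\to\mathbb{R}$ satisfy $$\rho_{k+1}=(B_k\rho_k)^\sigma,\qquad (B_k\rho_k)^\Delta=A_k\rho_k .$$ Put $\eta_k:=B_k+\mu A_k$, so that the second equation takes the form $\rho_{k+1}=\eta_k\rho_k$.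 The function $g_k$ denotes the ratio of subsequent functions $B_k$: $B_{k+1}=g_kB_k$; correspondingly $\eta_{k+1}=(\eta_kg_k)^\sigma$. **Hilbert spaces.** $\mu_\Delta$ is the Lebesgue $\Delta$-measure on $\mathbb{T}$, with $\mu_\Delta(\{x\})=\mu(x)$ for all $x\in\mathbb{T}$ (in particular $\mu_\Delta(\{\max\mathbb{T}\})=0$). $\mathcal{H}_k=L^2(\mathbb{T},\rho_k\mu_\Delta)$ is identified with a space of functions on $\mathbb{T}^\kappa$ with scalar product $$\langle\psi|\phi\rangle_k=\sum_{x\in\mathbb{T}^\kappa}\overline{\psi(x)}\,\phi(x)\,\rho_k(x)\,\mu(x).$$ **Operators.** Operators are in general unbounded, are defined on dense domains containing the functions with finite support, and are treated formally, without detailed discussion of domains. $I_k:\mathcal{H}_k\to\mathcal{H}_{k+1}$ is $I_k\psi=\psi$, and $\Delta:\mathcal{H}_k\to\mathcal{H}_{k+1}$ is $\Delta\psi(x)=\psi^\Delta(x)\,\chi_{\mathbb{T}^{\kappa\kappa}}(x)$. For functions $f_k,h_k:\mathbb{T}\to\mathbb{R}$ put $\mathcal{A}_k:=h_k\Delta+f_kI_k$ and $$\varphi_k:=f_k-\frac{h_k\,\chi_{\mathbb{T}^{\kappa\kappa}}}{\mu},$$ so that $\mathcal{A}_k\psi=\frac{h_k}{\mu}\,\psi^\sigma+\varphi_k\,\psi$. The adjoint $\mathcal{A}_k^*:\mathcal{H}_{k+1}\to\mathcal{H}_k$ is determined by $\langle\psi|\mathcal{A}_k\phi\rangle_{k+1}=\langle\mathcal{A}_k^*\psi|\phi\rangle_k$.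 The constant $b_k$ in the operator relation stands for $b_k$ times the identity operator.
   Formalization: The first relation is required only where ρ_{k+2}>0 and the second only where ρ_{k+1}>0, since the weights must vanish at points when 𝕋 has a maximum and the pointwise equivalence then fails; the operator equation is read on finitely supported functions, ρ_{k+1}μ_Δ-a.e. *)

(* Defs.v *)
From mathcomp Require Import all_boot all_order all_algebra.
From mathcomp Require Import complex.
From mathcomp Require Import all_classical all_reals all_analysis.

Set Implicit Arguments.
Unset Strict Implicit.
Unset Printing Implicit Defensive.

Import Order.TTheory GRing.Theory Num.Theory.
Import numFieldNormedType.Exports.

Local Open Scope classical_set_scope.
Local Open Scope complex_scope.
Local Open Scope ring_scope.

Section TimeScale.
Variable R : realType.
Implicit Types (T X : set R) (x : R).

(* [ubound X] is the set of all upper bounds of X, so this removes max X when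
   it exists and nothing otherwise; similarly for [kappam] and min X. *)
Definition kappa X : set R := X `\` ubound X.
Definition kappam X : set R := X `\` lbound X.

(* The case distinction implements inf set0 := max T (the library has
   inf set0 = 0). *)
Definition sigma T x : R :=
  if `[< exists2 t, T t & x < t >] then inf [set t | T t /\ x < t] else sup T.

Definition graininess T x : R := sigma T x - x.

Definition sigmaV T x : R := xget x [set y | kappa T y /\ sigma T y = x].

(* Every point except max T is right-scattered and every point except min T is
   left-scattered. *)
Definition discrete_time_scale T : Prop :=
  [/\ T !=set0, closed T,
      forall x, kappa T x -> x < sigma T x
    & forall x, kappam T x -> sup [set t | T t /\ t < x] < x].

(* f^sigma and f^(sigma^-1), truncated to 0 at max (T^kappa) and min T
   respectively.  There a quotient of truncated shifts is 0 since x / 0 = 0. *)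
Definition tshift T (f : R -> R) x : R :=
  f (sigma T x) * \1_(kappa (kappa T)) x.
Definition tshiftV T (f : R -> R) x : R :=
  f (sigmaV T x) * \1_(kappam (kappa T)) x.

Definition Delta_deriv T (f : R -> R) x : R := (f (sigma T x) - f x) / graininess T x.

(* The weights live on T^kappa; they are extended by 0, which is what gives a
   meaning to (B rho)^Delta at the maximum of T^kappa and is consistent with
   the truncated shift in the first equation. *)
Record weight_system T (rho A B : nat -> R -> R) : Prop := WeightSystem {
  weight_ge0 : forall k x, kappa T x -> 0 <= rho k x ;
  weight_ext : forall k x, ~ kappa T x -> rho k x = 0 ;
  weight_shift : forall k x, kappa T x ->
    rho k.+1 x = tshift T (fun y => B k y * rho k y) x ;
  weight_Delta : forall k x, kappa T x ->
    Delta_deriv T (fun y => B k y * rho k y) x = A k x * rho k x }.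

End TimeScale.

Section HilbertSpaces.
Variables (R : realType) (T : set R).
Local Notation C := R[i].
Implicit Types (w : R -> R) (psi phi : R -> C).

(* sum of an absolutely convergent real family *)
Definition rsum (f : R -> R) : R :=
  fine (\esum_(x in kappa T) (Num.max (f x) 0)%:E)
  - fine (\esum_(x in kappa T) (Num.max (- f x) 0)%:E).

Definition csum (f : R -> C) : C :=
  rsum (fun x => complex.Re (f x)) +i* rsum (fun x => complex.Im (f x)).

(* Only the values on T^kappa of a function R -> R[i] matter. *)
Definition w_L2 w psi : Prop :=
  (\esum_(x in kappa T) (Normc.normc (psi x) ^+ 2 * w x * graininess T x)%:E
     < +oo)%E.

Definition w_inner w psi phi : C :=
  csum (fun x => (psi x)^*%C * phi x * (w x * graininess T x)%:C).

(* "P holds (w mu_Delta)-almost everywhere": the atoms of w mu_Delta are the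
   points of T^kappa where w > 0, and two functions are equal in L^2 iff they
   agree there.  The restriction cannot be dropped: weight_shift forces
   rho (k+1) = 0 at the maximum of T^kappa when T has one, so the spaces
   L^2 (rho k mu_Delta) contain no information about such points. *)
Definition w_ae w (P : R -> Prop) : Prop := forall x, kappa T x -> 0 < w x -> P x.

Definition fin_supp psi : Prop :=
  finite_set [set x | kappa T x /\ psi x != 0].

Definition Delta psi (x : R) : C :=
  (psi (sigma T x) - psi x) / (graininess T x)%:C * \1_(kappa (kappa T)) x.

(* h Delta + f I *)
Definition Delta_op (h f : R -> R) psi (x : R) : C :=
  (h x)%:C * Delta psi x + (f x)%:C * psi x.

(* Value at psi of the adjoint of an operator P : L2 w -> L2 w' with the
   finitely supported functions as domain (it is unique as an element of L2 w,
   i.e. up to w-null points). *)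
Definition w_adjoint w w' (P : (R -> C) -> R -> C) psi : R -> C :=
  xget (fun=> 0)
    [set chi | w_L2 w chi /\
       forall phi, fin_supp phi -> w_inner w' psi (P phi) = w_inner w chi phi].

End HilbertSpaces.

(* Main.v *)
Require Import Defs.
From mathcomp Require Import all_boot all_order all_algebra.
From mathcomp Require Import complex.
From mathcomp Require Import all_classical all_reals all_analysis.
From mathcomp Require Import ring lra.


(* On finitely supported functions the adjoint is explicit: summing by parts
   along sigma, and using rho_{k+1} = (B_k rho_k)^sigma = eta_k rho_k,
     A_k^* psi = phi_k eta_k psi + (B_k / mu) (h_k psi)^{sigma^-1},
   where phi_k = f_k - h_k chi / mu.  Hence A_k A_k^* and A_{k+1}^* A_{k+1} are
   both three-term operators in psi^sigma, psi and psi^{sigma^-1}, and the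
   operator equation holds iff the three coefficients agree.  The coefficient of
   psi^sigma gives the first relation, because eta_{k+1} = (eta_k g_k)^sigma.
   That of psi^{sigma^-1} gives the same relation shifted by sigma^-1, because
   B_{k+1} = g_k B_k.  The coefficient of psi, after eliminating phi_{k+1} with
   the first relation, is the second one.
   Where eta_k^sigma (resp. B_k) vanishes the off-diagonal coefficients are
   trivially equal; these are exactly the points at which the weight rho_{k+2}
   vanishes, so nothing is asserted there by the first relation. *)

Set Implicit Arguments.
Unset Strict Implicit.
Unset Printing Implicit Defensive.

Import Order.TTheory GRing.Theory Num.Theory.
Import numFieldNormedType.Exports.

Local Open Scope classical_set_scope.
Local Open Scope complex_scope.
Local Open Scope ring_scope.

(** * Suprema and infima of subsets of a closed set *)

Lemma closed_sup (R : realType) (T S : set R) :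
  closed T -> S `<=` T -> has_sup S -> T (sup S).
Proof.
move=> /closure_id cT ST [S0 Sub]; rewrite cT.
exact: (closureS ST (closure_sup S0 Sub)).
Qed.

Lemma closed_inf (R : realType) (T S : set R) :
  closed T -> S `<=` T -> has_inf S -> T (inf S).
Proof.
move=> cT ST infS; apply: contrapT => nT.
have /closure_id cE := cT; rewrite cE in nT.
apply: nT => U /nbhs_ballP[e e0 eU].
have [s Ss sI] := inf_adherent e0 infS.
exists s; split; first exact: ST.
apply: eU; rewrite /ball /= distrC ger0_norm; first by rewrite ltrBlDl.
by rewrite subr_ge0; apply: ge_inf => //; case: infS.
Qed.

(** * The forward jump and its inverse on a discrete time scale *)

Section TimeScale.
Variables (R : realType) (T : set R).
Hypothesis hT : discrete_time_scale T.
Local Notation K := (kappa T).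

Lemma kappa_gt x : K x <-> T x /\ exists2 t, T t & x < t.
Proof.
split=> [[Tx nub]|[Tx [t Tt xt]]].
  split=> //; apply: contrapT => nt; apply: nub => t Tt.
  by rewrite leNgt; apply/negP => xt; apply: nt; exists t.
by split=> // /(_ _ Tt); rewrite leNgt xt.
Qed.

Lemma kappaT x : K x -> T x. Proof. by case. Qed.

Lemma sigma_gt x : K x -> x < sigma T x.
Proof. by case: hT => _ _ + _ => /(_ x). Qed.

Lemma graininess_gt0 x : K x -> 0 < graininess T x.
Proof. by move=> /sigma_gt; rewrite /graininess subr_gt0. Qed.

Lemma sigmaE x : K x -> sigma T x = inf [set t | T t /\ x < t].
Proof. by move=> /kappa_gt[_ xT]; rewrite /sigma asboolT. Qed.

Let has_inf_gt x : K x -> has_inf [set t | T t /\ x < t].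
Proof.
move=> /kappa_gt[_ [t Tt xt]]; split; first by exists t.
by exists x => y [_ /ltW].
Qed.

Lemma sigma_in x : K x -> T (sigma T x).
Proof.
move=> Kx; rewrite sigmaE//; case: hT => _ cT _ _.
by apply: closed_inf => //; [move=> t [] | exact: has_inf_gt].
Qed.

Lemma sigma_le x t : K x -> T t -> x < t -> sigma T x <= t.
Proof.
by move=> Kx Tt xt; rewrite sigmaE//; apply: ge_inf => //;
  case: (has_inf_gt Kx).
Qed.

(** If x < y, then [sigma T x] <= y < [sigma T y], so the forward jump is strictly increasing on
    [kappa T]. *)
Lemma sigma_inj x y : K x -> K y -> sigma T x = sigma T y -> x = y.
Proof.
move=> Kx Ky xy; apply/eqP; rewrite eq_le !leNgt.
apply/andP; split; apply/negP => h.
- by have := sigma_le Ky (kappaT Kx) h; rewrite leNgt -xy sigma_gt.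
- by have := sigma_le Kx (kappaT Ky) h; rewrite leNgt xy sigma_gt.
Qed.

Lemma sigmaK x : K x -> sigmaV T (sigma T x) = x.
Proof.
by move=> Kx; apply: xget_unique => // y [Ky] /sigma_inj; apply.
Qed.

Lemma kappaK x : kappa K x -> K x. Proof. by case. Qed.

(** A point of [kappa T] after x is at least [sigma T x] and is not an upper bound of T, so neither
    is [sigma T x]. Conversely, [sigma T x] itself is a point of [kappa T] after x. *)
Lemma kappa2P x : K x -> kappa K x <-> K (sigma T x).
Proof.
move=> Kx; split=> [[_ nub]|Ks].
  have [y Ky xy] : exists2 y, K y & x < y.
    apply: contrapT => ny; apply: nub => y Ky.
    by rewrite leNgt; apply/negP => xy; apply: ny; exists y.
  split; first exact: sigma_in.
  case: Ky => Ty nuby /= ubs; apply: nuby => t Tt.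
  by rewrite (le_trans (ubs _ Tt))// sigma_le.
by split=> // /(_ _ Ks); rewrite leNgt sigma_gt.
Qed.

Lemma sigma_kappam x : kappa K x -> kappam K (sigma T x).
Proof.
move=> KKx; have Kx := kappaK KKx; split; first exact/kappa2P.
by move=> /(_ _ Kx); rewrite leNgt sigma_gt.
Qed.

(** The predecessor is the supremum y of the points before x: closedness puts y in T and
    left-scatteredness gives y < x. If [sigma T y] were below x, it would be one of those points,
    hence at most y. *)
Lemma sigmaVP x : kappam K x ->
  kappa K (sigmaV T x) /\ sigma T (sigmaV T x) = x.
Proof.
move=> [Kx nlb].
have [z Kz zx] : exists2 z, K z & z < x.
  apply: contrapT => nz; apply: nlb => z Kz.
  by rewrite leNgt; apply/negP => xz; apply: nz; exists z.
pose S := [set t | T t /\ t < x]; pose y := sup S.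
have supS : has_sup S.
  by split; [exists z; split=> //; exact: kappaT | exists x => t [_ /ltW]].
have [_ cT _ lscat] := hT.
have Ty : T y by apply: closed_sup => // t [].
have yx : y < x.
  apply: lscat; split; first exact: kappaT.
  by move=> /(_ _ (kappaT Kz)); rewrite leNgt zx.
have Ky : K y by apply/kappa_gt; split=> //; exists x => //; exact: kappaT.
have sy : sigma T y = x.
  apply/eqP; rewrite eq_le sigma_le//=; last exact: kappaT.
  rewrite leNgt; apply/negP => sx.
  have : sigma T y <= y.
    by apply: ub_le_sup; [case: supS | split=> //; exact: sigma_in].
  by rewrite leNgt sigma_gt.
by rewrite -sy sigmaK//; split=> //; apply/kappa2P => //; rewrite sy.
Qed.

(** This is the change of index behind summation by parts. *)
Lemma sigma_bij : set_bij (kappa K) (kappam K) (sigma T).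
Proof.
split=> [x KKx|x y /set_mem KKx /set_mem KKy|x kx].
- exact: sigma_kappam.
- by apply: sigma_inj; exact: kappaK.
- by have [? ?] := sigmaVP kx; exists (sigmaV T x).
Qed.

End TimeScale.

(** * Sums of finitely supported functions *)

Section Sums.
Variables (R : realType) (T : set R).
Local Notation K := (kappa T).
Local Notation C := R[i].

Lemma esum_finite_support (D : set R) (F : R -> R) :
  finite_set D -> D `<=` K -> (forall x, 0 <= F x) ->
  (forall x, K x -> ~ D x -> F x = 0) ->
  \esum_(x in K) (F x)%:E = (\sum_(x \in D) F x)%:E.
Proof.
move=> finD DK F0 FD; rewrite (esumID D); last by move=> x _; rewrite lee_fin.
rewrite setIC (setIidl DK) [X in (_ + X)%E]esum1 ?adde0.
  by rewrite esum_fset ?fsumEFin// => x _; rewrite lee_fin.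
by move=> x [Kx nDx]; rewrite FD.
Qed.

Lemma rsum_finite_support (D : set R) (F : R -> R) :
  finite_set D -> D `<=` K -> (forall x, K x -> ~ D x -> F x = 0) ->
  rsum T F = \sum_(x \in D) F x.
Proof.
move=> finD DK FD; rewrite /rsum !(@esum_finite_support D)//=.
- rewrite !fsbig_finite// -sumrB; apply: eq_bigr => x _.
  by rewrite /Num.max; case: ifP; case: ifP; lra.
- by move=> x; rewrite le_max lexx orbT.
- by move=> x Kx Dx; rewrite FD// oppr0 maxxx.
- by move=> x; rewrite le_max lexx orbT.
- by move=> x Kx Dx; rewrite FD// maxxx.
Qed.

Lemma csum_finite_support (D : set R) (F : R -> C) :
  finite_set D -> D `<=` K -> (forall x, K x -> ~ D x -> F x = 0) ->
  csum T F = \sum_(x \in D) F x.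
Proof.
move=> finD DK FD; rewrite /csum !(@rsum_finite_support D)//; last 2 first.
- by move=> x Kx Dx; rewrite FD.
- by move=> x Kx Dx; rewrite FD.
rewrite [LHS]complexE/= !fsbig_finite// !rmorph_sum mulr_sumr -big_split/=.
by apply: eq_bigr => x _; rewrite [RHS]complexE.
Qed.

(** In this form the index set can be shrunk to the support of a truncation and reindexed along
    [sigma T]. *)
Lemma csum_fsbig (F : R -> C) : fin_supp T F -> csum T F = \sum_(x \in K) F x.
Proof.
move=> finF; rewrite (csum_finite_support finF).
- apply: fsbig_widen => [x []//|x [Kx /= nF]].
  by apply: contrapT => /eqP F0; apply: nF.
- by move=> x [].
- by move=> x Kx nF; apply: contrapT => /eqP F0; apply: nF.
Qed.

Lemma csumD (F G : R -> C) : fin_supp T F -> fin_supp T G ->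
  csum T (fun x => F x + G x) = csum T F + csum T G.
Proof.
move=> finF finG.
pose D := [set x | K x /\ F x != 0] `|` [set x | K x /\ G x != 0].
have finD : finite_set D by rewrite finite_setU.
have DK : D `<=` K by move=> x [[]|[]].
have FD x : K x -> ~ D x -> F x = 0.
  by move=> Kx nD; apply: contrapT => /eqP F0; apply: nD; left.
have GD x : K x -> ~ D x -> G x = 0.
  by move=> Kx nD; apply: contrapT => /eqP G0; apply: nD; right.
rewrite !(@csum_finite_support D)//; first exact: fsbig_split.
by move=> x Kx nD; rewrite FD// GD// addr0.
Qed.

Lemma eq_csum (F G : R -> C) : (forall x, K x -> F x = G x) ->
  csum T F = csum T G.
Proof.
by move=> FG; rewrite /csum /rsum; congr (_ +i* _); congr (_ - _); congr fine;
  apply: eq_esum => x Kx; rewrite FG.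
Qed.

Lemma sub_fin_supp (F G : R -> C) :
  (forall x, K x -> G x = 0 -> F x = 0) -> fin_supp T G -> fin_supp T F.
Proof.
move=> FG; apply: sub_finite_set => x [Kx F0]; split=> //.
by apply: contra F0 => /eqP/(FG _ Kx)/eqP.
Qed.

Lemma fin_suppD (F G : R -> C) : fin_supp T F -> fin_supp T G ->
  fin_supp T (fun x => F x + G x).
Proof.
move=> finF finG.
have : finite_set ([set x | K x /\ F x != 0] `|` [set x | K x /\ G x != 0]).
  by rewrite finite_setU.
apply: sub_finite_set => x [Kx FG].
have [F0|F0] := eqVneq (F x) 0; last by left.
by right; split=> //; move: FG; rewrite F0 add0r.
Qed.

(** Point masses are the test functions that read off values of the adjoint and isolate coefficients
    of three-term expressions. *)
Lemma fin_supp_delta (y : R) : fin_supp T (fun x => (x == y)%:R : C).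
Proof.
apply: (@sub_finite_set _ _ [set y]) => // x [_] /=.
by case: (eqVneq x y) => //= _ /negP[].
Qed.

Lemma w_L2_fin_supp (w : R -> R) (psi : R -> C) :
  (forall x, K x -> 0 <= w x * graininess T x) ->
  fin_supp T psi -> w_L2 T w psi.
Proof.
move=> w0 finpsi; rewrite /w_L2.
rewrite (esumID [set x | K x /\ psi x != 0]); last first.
  move=> x Kx; rewrite lee_fin -mulrA mulr_ge0 ?w0// exprn_ge0//.
  by case: (psi x) => r i /=; exact: sqrtr_ge0.
rewrite [X in (_ + X)%E]esum1 ?adde0.
  rewrite setIC setIidl; last by move=> x [].
  rewrite esum_fset// ?fsumEFin ?ltry// => x; rewrite inE => -[Kx _].
  rewrite lee_fin -mulrA mulr_ge0 ?w0// exprn_ge0//.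
  by case: (psi x) => r i /=; exact: sqrtr_ge0.
move=> x [Kx npsi].
have -> : psi x = 0 by apply: contrapT => /eqP p0; apply: npsi.
by rewrite Normc.normc0 expr0n/= !mul0r.
Qed.

End Sums.

(** * The explicit adjoint of h Delta + f I *)

Lemma conjc_lin (R : realType) (r s : R) (z t : R[i]) :
  (r%:C * z + s%:C * t)^*%C = r%:C * z^*%C + s%:C * t^*%C.
Proof.
by rewrite rmorphD; congr (_ + _); rewrite rmorphM; congr (_ * _);
  exact: conjc_real.
Qed.

Section Adjoint.
Variables (R : realType) (T : set R).
Hypothesis hT : discrete_time_scale T.
Local Notation K := (kappa T).
Local Notation C := R[i].
Local Notation m := (graininess T).

(* phi in the paper *)
Definition diag_coef (h f : R -> R) x : R := f x - h x * \1_(kappa K) x / m x.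

Lemma Delta_opE (h f : R -> R) (psi : R -> C) x :
  Delta_op T h f psi x =
  (h x / m x * \1_(kappa K) x)%:C * psi (sigma T x)
  + (diag_coef h f x)%:C * psi x.
Proof.
rewrite /Delta_op /Delta /diag_coef !indicE.
by case: (x \in kappa K); rewrite /= -fmorphV; ring.
Qed.

(** The support of F lies in the image under [sigmaV T] of the support of psi. *)
Lemma fin_supp_sigma (psi : R -> C) (F : R -> C) : fin_supp T psi ->
  (forall x, kappa K x -> psi (sigma T x) = 0 -> F x = 0) ->
  (forall x, K x -> ~ kappa K x -> F x = 0) ->
  fin_supp T F.
Proof.
move=> /(finite_image (sigmaV T)) fin F0 nF.
apply: sub_finite_set fin => x [Kx Fx].
have [KKx|nKKx] := pselect (kappa K x); last by rewrite nF ?eqxx in Fx.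
exists (sigma T x); last exact: sigmaK.
split; first exact/kappa2P.
by apply: contra Fx => /eqP/(F0 _ KKx) ->.
Qed.

Lemma fin_supp_sigmaV (psi : R -> C) (F : R -> C) : fin_supp T psi ->
  (forall x, kappam K x -> psi (sigmaV T x) = 0 -> F x = 0) ->
  (forall x, K x -> ~ kappam K x -> F x = 0) ->
  fin_supp T F.
Proof.
move=> /(finite_image (sigma T)) fin F0 nF.
apply: sub_finite_set fin => x [Kx Fx].
have [kx|nkx] := pselect (kappam K x); last by rewrite nF ?eqxx in Fx.
have [KKy yx] := sigmaVP hT kx.
exists (sigmaV T x); last exact: yx.
split; first exact: kappaK.
by apply: contra Fx => /eqP/(F0 _ kx) ->.
Qed.

Lemma Delta_op_fin_supp (h f : R -> R) (psi : R -> C) :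
  fin_supp T psi -> fin_supp T (Delta_op T h f psi).
Proof.
move=> fin; rewrite (funext (Delta_opE h f psi)); apply: fin_suppD.
  apply: (fin_supp_sigma fin) => [x _ ->|x _ nKKx]; first by rewrite mulr0.
  by rewrite indicE memNset// mulr0 mul0r.
by apply: sub_fin_supp fin => x _ ->; rewrite mulr0.
Qed.

Variables (h f w w' B e : R -> R).
Hypotheses (w_ge0 : forall x, K x -> 0 <= w x)
  (w'_shift : forall x, K x -> w' x = tshift T (fun y => B y * w y) x)
  (w'_mul : forall x, K x -> w' x = e x * w x).

(** Here e is the ratio of the weights, eta_k in the application. At the minimum of [kappa T], where
    [sigmaV T x] takes its default value x, the truncated shift of h removes the second term. *)
Definition formal_adjoint (psi : R -> C) x : C :=
  (diag_coef h f x * e x)%:C * psi x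
  + (B x / m x * tshiftV T h x)%:C * psi (sigmaV T x).

Lemma formal_adjoint_fin_supp (psi : R -> C) :
  fin_supp T psi -> fin_supp T (formal_adjoint psi).
Proof.
move=> fin; apply: fin_suppD.
  by apply: sub_fin_supp fin => x _ ->; rewrite mulr0.
apply: (fin_supp_sigmaV fin) => [x _ ->|x _ nkx]; first by rewrite mulr0.
by rewrite /tshiftV indicE memNset// !mulr0 mul0r.
Qed.

(** Summation by parts: the diagonal terms match by [w'_mul]; the shifted terms match after
    reindexing along [sigma T], since w' at x is B w at [sigma T x]. Finite support of phi makes all
    sums finite, for arbitrary psi. *)
Lemma w_inner_formal_adjoint (psi phi : R -> C) : fin_supp T phi ->
  w_inner T w' psi (Delta_op T h f phi) = w_inner T w (formal_adjoint psi) phi.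
Proof.
move=> fin.
(* G and H are the shifted and diagonal halves of the left side; G' is what G becomes once the
   argument of phi is x. *)
pose G x := (psi x)^*%C * (h x * w' x * \1_(kappa K) x)%:C * phi (sigma T x).
pose H x := (psi x)^*%C * (diag_coef h f x * w' x * m x)%:C * phi x.
pose G' x := (psi (sigmaV T x))^*%C * (B x * w x * tshiftV T h x)%:C * phi x.
have finG : fin_supp T G.
  apply: (fin_supp_sigma fin) => [x _|x _ nKKx]; rewrite /G.
    by move->; rewrite mulr0.
  by rewrite indicE memNset// !mulr0 mul0r.
have finH : fin_supp T H.
  by apply: sub_fin_supp fin => x _; rewrite /H => ->; rewrite mulr0.
have finG' : fin_supp T G'.
  by apply: sub_fin_supp fin => x _; rewrite /G' => ->; rewrite mulr0.
transitivity (csum T (fun x => G x + H x)).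
  apply: eq_csum => x Kx; rewrite Delta_opE /G /H.
  have m0 : (m x)%:C != 0 by rewrite fmorph_eq0 gt_eqF// graininess_gt0.
  by field.
transitivity (csum T (fun x => G' x + H x)); last first.
  apply: eq_csum => x Kx; rewrite /formal_adjoint /G' /H.
  rewrite conjc_lin w'_mul//.
  have m0 : (m x)%:C != 0 by rewrite fmorph_eq0 gt_eqF// graininess_gt0.
  by field.
rewrite !csumD//; congr (_ + _); rewrite !csum_fsbig//.
have -> : \sum_(x \in K) G x = \sum_(x \in kappa K) G x.
  symmetry; apply: fsbig_widen => [|x [Kx nKKx]]; first exact: kappaK.
  by rewrite /G /= indicE memNset// !mulr0 mul0r.
have -> : \sum_(x \in K) G' x = \sum_(x \in kappam K) G' x.
  symmetry; apply: fsbig_widen => [x []//|x [Kx nkx]].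
  by rewrite /G' /tshiftV /= indicE memNset// !mulr0 mul0r.
rewrite (@reindex_fsbig _ _ _ _ _ (sigma T) (kappa K) (kappam K));
  last exact: sigma_bij.
apply: eq_fsbigr => x /set_mem KKx.
have Kx := kappaK KKx.
rewrite /G /G' /tshiftV sigmaK// w'_shift// /tshift !indicE.
rewrite (mem_set KKx) (mem_set (sigma_kappam hT KKx)) !mulr1.
by ring.
Qed.

(** The adjoint is an unspecified choice among the functions with the adjoint property. The formal
    adjoint shows that one exists, and testing against the point mass at y fixes its value there,
    because y has positive mass. *)
Lemma w_adjointE (psi : R -> C) y : fin_supp T psi -> K y -> 0 < w y ->
  w_adjoint T w w' (Delta_op T h f) psi y = formal_adjoint psi y.
Proof.
move=> finpsi Ky wy; rewrite /w_adjoint.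
set S := [set chi | _].
have [_ Sx] : S (xget (fun=> 0) S).
  apply: xgetPex; exists (formal_adjoint psi); split.
    apply: w_L2_fin_supp => [x Kx|]; last exact: formal_adjoint_fin_supp.
    by rewrite mulr_ge0 ?w_ge0// ltW// graininess_gt0.
  by move=> phi; exact: w_inner_formal_adjoint.
pose d x : C := (x == y)%:R.
have inner_d chi : w_inner T w chi d = (chi y)^*%C * (w y * m y)%:C.
  rewrite /w_inner (@csum_finite_support _ _ [set y])//.
  - by rewrite fsbig_set1 /d eqxx mulr1.
  - by move=> x ->.
  - by move=> x _ /= /eqP/negPf xy; rewrite /d xy mulr0 mul0r.
have := Sx d (fin_supp_delta T y).
rewrite w_inner_formal_adjoint ?inner_d; last exact: fin_supp_delta.
have nz : (w y * m y)%:C != 0 :> C.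
  by rewrite fmorph_eq0 mulf_neq0// gt_eqF// graininess_gt0.
by move=> /(mulIf nz)/(can_inj (@conjcK _)) ->.
Qed.

End Adjoint.

(** * Separating the coefficients of a three-term expression *)

Section ThreeTerm.
Variables (R : realType) (T : set R).
Hypothesis hT : discrete_time_scale T.
Local Notation K := (kappa T).
Local Notation C := R[i].

(** Away from the minimum of [kappa T] the three evaluation points are distinct, so a point mass at
    each isolates one coefficient. At the minimum, [sigmaV T x] is x by default and [ga] would mix
    with [be]; this is why [ga] is required to vanish there. *)
Lemma three_term_eq0 (al be ga : R) x : kappa K x ->
  (~ kappam K x -> ga = 0) ->
  (forall psi : R -> C, fin_supp T psi ->
     al%:C * psi (sigma T x) + be%:C * psi x + ga%:C * psi (sigmaV T x) = 0) ->
  [/\ al = 0, be = 0 & ga = 0].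
Proof.
move=> KKx ga0 eq0.
have Kx := kappaK KKx.
have sx := sigma_gt hT Kx.
have gaE z : z != sigmaV T x -> ga%:C * (sigmaV T x == z)%:R = 0 :> C.
  by move=> /negPf; rewrite eq_sym => ->; rewrite mulr0.
have gaV z : x <= z -> ga%:C * (sigmaV T x == z)%:R = 0 :> C.
  move=> xz; have [kx|/ga0 ->] := pselect (kappam K x); last by rewrite mul0r.
  have [/kappaK Ky yx] := sigmaVP hT kx.
  by apply: gaE; rewrite gt_eqF// (lt_le_trans _ xz)// -{2}yx sigma_gt.
split; apply: complexI.
- have := eq0 _ (fin_supp_delta T (sigma T x)).
  by rewrite eqxx (lt_eqF sx) gaV ?(ltW sx)// mulr1 mulr0 !addr0.
- have := eq0 _ (fin_supp_delta T x).
  by rewrite eqxx (gt_eqF sx) gaV// mulr1 mulr0 addr0 add0r.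
- have [kx|/ga0 -> //] := pselect (kappam K x).
  have [/kappaK Ky yx] := sigmaVP hT kx.
  have yx' : sigmaV T x < x by rewrite -{2}yx sigma_gt.
  have := eq0 _ (fin_supp_delta T (sigmaV T x)).
  by rewrite eqxx (gt_eqF yx') (gt_eqF (lt_trans yx' sx)) mulr1 !mulr0 !add0r.
Qed.

End ThreeTerm.

(** * Positivity and recurrences of the weights *)

Section Weights.
Variables (R : realType) (T : set R) (rho A B g : nat -> R -> R).
Hypotheses (hT : discrete_time_scale T) (hrho : weight_system T rho A B)
  (hg : forall k x, T x -> B k.+1 x = g k x * B k x).
Local Notation K := (kappa T).
Local Notation m := (graininess T).
Local Notation eta k x := (B k x + m x * A k x).

Lemma weight_gt0 k x : K x -> rho k x != 0 -> 0 < rho k x.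
Proof. by move=> Kx nz; rewrite lt_def nz (weight_ge0 hrho). Qed.

(** The Delta equation says that B_k rho_k at [sigma T x] equals eta_k rho_k at x. At the maximum of
    [kappa T] the truncated shift is 0, and so is rho_k at [sigma T x], by the extension by zero. *)
Lemma weight_mul k x : K x -> rho k.+1 x = eta k x * rho k x.
Proof.
move=> Kx; rewrite (weight_shift hrho)// /tshift.
have m0 : m x != 0 by rewrite gt_eqF// graininess_gt0.
have Es : B k (sigma T x) * rho k (sigma T x) = eta k x * rho k x.
  have := weight_Delta hrho k Kx; rewrite /Delta_deriv.
  by move=> /(canRL (divfK m0))/(canRL (subrK _)) ->; ring.
have [KKx|nKKx] := pselect (kappa K x).
  by rewrite Es indicE mem_set// mulr1.
rewrite -Es (weight_ext hrho) ?mulr0 ?mul0r//.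
by move=> /(kappa2P hT Kx).
Qed.

Lemma weight_pred_gt0 k x : K x -> 0 < rho k.+1 x -> 0 < rho k x.
Proof.
move=> Kx; rewrite weight_mul// => pos; apply: weight_gt0 => //.
by apply/eqP => r0; rewrite r0 mulr0 ltxx in pos.
Qed.

(** The truncated shift makes rho_{k+1} vanish at the maximum of [kappa T]. *)
Lemma weight_succ_gt0_kappa2 k x : K x -> 0 < rho k.+1 x -> kappa K x.
Proof.
move=> Kx; rewrite (weight_shift hrho)// /tshift indicE.
case: (boolP (x \in kappa K)) => [/set_mem//|_].
by rewrite mulr0 ltxx.
Qed.

Lemma weight_sigma k x : kappa K x ->
  rho k.+1 x = B k (sigma T x) * rho k (sigma T x).
Proof.
move=> KKx; rewrite (weight_shift hrho); last exact: kappaK.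
by rewrite /tshift indicE mem_set// mulr1.
Qed.

Lemma weight_sigma_gt0 k x : kappa K x -> 0 < rho k.+1 x ->
  0 < rho k (sigma T x).
Proof.
move=> KKx; rewrite weight_sigma// => pos.
apply: weight_gt0; first by apply/kappa2P => //; exact: kappaK.
by apply/eqP => r0; rewrite r0 mulr0 ltxx in pos.
Qed.

(** Both sides times rho_{k+1}(x) give rho_{k+2}(x): one uses the product form at x, the other first
    shifts to [sigma T x] and uses B_{k+1} = g_k B_k and the product form there. *)
Lemma eta_succ k x : K x -> 0 < rho k.+1 x ->
  eta k.+1 x = eta k (sigma T x) * g k (sigma T x).
Proof.
move=> Kx pos; have KKx := weight_succ_gt0_kappa2 Kx pos.
have Ks : K (sigma T x) by apply/kappa2P.
apply: (mulIf (lt0r_neq0 pos)); rewrite -weight_mul// weight_sigma//.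
rewrite hg; last exact: kappaT.
by rewrite weight_mul// weight_sigma//; ring.
Qed.

End Weights.

(** * The coefficients of the operator equation *)

Section Coefficients.
Variables (R : realType) (T : set R) (rho A B g h f : nat -> R -> R).
Variables (a b : R) (k : nat).
Hypotheses (hT : discrete_time_scale T) (hrho : weight_system T rho A B)
  (hg : forall k x, T x -> B k.+1 x = g k x * B k x).
Local Notation K := (kappa T).
Local Notation C := R[i].
Local Notation m := (graininess T).
Local Notation eta k x := (B k x + m x * A k x).
Local Notation phi k := (diag_coef T (h k) (f k)).
Local Notation opA k := (Delta_op T (h k) (f k)).
Local Notation opA' k := (w_adjoint T (rho k) (rho k.+1) (opA k)).

(** With the two definitions below, these are the coefficients of psi at [sigma T x], x and
    [sigmaV T x] in the difference of the two sides of the operator equation. *)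
Definition coef_up x : R :=
  (h k x * phi k (sigma T x) - a * g k (sigma T x) * h k.+1 x * phi k.+1 x)
  * eta k (sigma T x) / m x.

Definition coef_diag x : R :=
  h k x ^+ 2 * B k (sigma T x) / (m x * m (sigma T x)) + phi k x ^+ 2 * eta k x
  - a * (phi k.+1 x ^+ 2 * eta k (sigma T x) * g k (sigma T x)
         + g k x * B k x * tshiftV T (h k.+1) x ^+ 2 / (m x * tshiftV T m x))
  - b.

Definition coef_down x : R :=
  (phi k x * tshiftV T (h k) x
   - a * g k x * tshiftV T (h k.+1) x * phi k.+1 (sigmaV T x)) * B k x / m x.

(** Positivity of rho_{k+1} at x propagates to rho_k at x and at [sigma T x], so every adjoint value
    that occurs is given by the explicit formula. *)
Lemma commutator_coef (psi : R -> C) x : fin_supp T psi -> K x ->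
  0 < rho k.+1 x ->
  opA k (opA' k psi) x - (a%:C * opA' k.+1 (opA k.+1 psi) x + b%:C * psi x)
  = (coef_up x)%:C * psi (sigma T x) + (coef_diag x)%:C * psi x
    + (coef_down x)%:C * psi (sigmaV T x).
Proof.
move=> fin Kx pos.
have KKx := weight_succ_gt0_kappa2 hrho Kx pos.
have Ks : K (sigma T x) by apply/kappa2P.
have m0 : m x != 0 by rewrite gt_eqF// graininess_gt0.
have ms0 : m (sigma T x) != 0 by rewrite gt_eqF// graininess_gt0.
have adjE j (chi : R -> C) y : fin_supp T chi -> K y -> 0 < rho j y ->
    opA' j chi y = (phi j y * eta j y)%:C * chi y
      + (B j y / m y * tshiftV T (h j) y)%:C * chi (sigmaV T y).
  exact: (@w_adjointE _ _ hT _ _ _ _ _ (fun z => eta j z) (weight_ge0 hrho j)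
    (weight_shift hrho j) (fun z => weight_mul hT hrho j (x := z))).
rewrite adjE//; last exact: Delta_op_fin_supp.
rewrite Delta_opE !adjE//; first last.
- exact: (weight_sigma_gt0 hT hrho KKx pos).
- exact: (weight_pred_gt0 hT hrho Kx pos).
rewrite !Delta_opE (eta_succ hT hrho hg Kx pos) hg; last exact: kappaT.
rewrite /coef_up /coef_diag /coef_down /tshiftV !indicE !sigmaK//.
rewrite (mem_set KKx) (mem_set (sigma_kappam hT KKx)).
have mC0 : (m x)%:C != 0 :> C by rewrite fmorph_eq0.
have msC0 : (m (sigma T x))%:C != 0 :> C by rewrite fmorph_eq0.
have [kx|nkx] := pselect (kappam K x); last first.
  rewrite (memNset nkx) !mulr0 !mulr1 invr0 mulr0.
  (* At the minimum of [kappa T] this quotient, taken at a default point, only enters multiplied by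
     zero, so its value is arbitrary. *)
  move: (_ / m (sigmaV T x) * _) => r.
  by field; exact/andP.
have [KKy yx] := sigmaVP hT kx.
have mv0 : m (sigmaV T x) != 0.
  by rewrite gt_eqF// graininess_gt0//; exact: kappaK.
have mvC0 : (m (sigmaV T x))%:C != 0 :> C by rewrite fmorph_eq0.
rewrite yx (mem_set kx) (mem_set KKy) !mulr1.
by field; exact/and3P.
Qed.

(** Squaring the first relation replaces phi_{k+1}^2 by a multiple of h_k^2 / h_{k+1}^2; where eta_k
    vanishes at [sigma T x], both terms concerned are zero. What remains is a linear
    rearrangement. *)
Lemma coef_diag_eq0 x : kappa K x -> a != 0 -> g k x != 0 ->
  g k (sigma T x) != 0 -> h k.+1 x != 0 ->
  (eta k (sigma T x) != 0 ->
   a * g k (sigma T x) * h k.+1 x * phi k.+1 x = h k x * phi k (sigma T x)) ->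
  coef_diag x = 0 <->
  a * g k x *
    (B k x * tshiftV T (h k.+1) x ^+ 2 / (m x * tshiftV T m x)
     - a^-1 * (phi k x ^+ 2 * eta k x / g k x)) + b
  = tshift T (B k) x * h k x ^+ 2 / (tshift T m x * m x)
    - a^-1 * (tshift T (phi k) x ^+ 2 * tshift T (fun y => eta k y) x
              / tshift T (g k) x) * (h k x ^+ 2 / h k.+1 x ^+ 2).
Proof.
move=> KKx a0 g0 gs0 h0 up.
rewrite /tshift !indicE (mem_set KKx) !mulr1.
have m0 : m x != 0 by rewrite gt_eqF// graininess_gt0//; exact: kappaK.
have ms0 : m (sigma T x) != 0.
  by rewrite gt_eqF// graininess_gt0//; apply/kappa2P => //; exact: kappaK.
have upE : a^-1 * (phi k (sigma T x) ^+ 2 * eta k (sigma T x) / g k (sigma T x))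
      * (h k x ^+ 2 / h k.+1 x ^+ 2)
    = a * (phi k.+1 x ^+ 2 * eta k (sigma T x) * g k (sigma T x)).
  have [->|/up] := eqVneq (eta k (sigma T x)) 0.
    by rewrite !(mulr0, mul0r).
  move: (eta _ _) => E hE.
  transitivity ((h k x * phi k (sigma T x)) ^+ 2 * E
    / (a * g k (sigma T x) * h k.+1 x ^+ 2)); first by field; rewrite a0 gs0 h0.
  by rewrite -hE; field; rewrite a0 gs0 h0.
set V := tshiftV T (h k.+1) x; set M := m x * tshiftV T m x.
have lhsE : a * g k x * (B k x * V ^+ 2 / M
    - a^-1 * (phi k x ^+ 2 * eta k x / g k x))
    = a * (g k x * B k x * V ^+ 2 / M) - phi k x ^+ 2 * eta k x.
  (* M is 0 at the minimum of [kappa T], so its inverse is kept as an opaque factor. *)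
  by move: M^-1 => r; field; rewrite g0 a0.
rewrite upE lhsE /coef_diag -/V -/M.
by rewrite (mulrC (m (sigma T x))) (mulrC (B k (sigma T x))); split=> E; lra.
Qed.
End Coefficients.

(** * Comparing coefficients in both directions *)

Theorem proposition3p1 (R : realType) (T : set R)
    (rho A B g h f : nat -> R -> R) (a b : nat -> R)
    (hT : discrete_time_scale T)
    (hrho : weight_system T rho A B)
    (hg : forall k x, T x -> B k.+1 x = g k x * B k x)
    (g_neq0 : forall k x, kappa T x -> g k x != 0)
    (h_neq0 : forall k x, kappa (kappa T) x -> h k.+1 x != 0)
    (a_neq0 : forall k, a k != 0) :
  let m := graininess T in
  let eta k (x : R) := B k x + m x * A k x in
  let phi k (x : R) := f k x - h k x * \1_(kappa (kappa T)) x / m x in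
  let opA k := Delta_op T (h k) (f k) in
  let opA' k := w_adjoint T (rho k) (rho k.+1) (opA k) in
  (forall k (psi : R -> R[i]), fin_supp T psi ->
     w_ae T (rho k.+1) (fun x =>
       opA k (opA' k psi) x
       = (a k)%:C * opA' k.+1 (opA k.+1 psi) x + (b k)%:C * psi x))
  <->
  (forall k,
     w_ae T (rho k.+2) (fun x =>
       h k.+1 x * phi k.+1 x
       = (a k)^-1 * (h k x * tshift T (phi k) x / tshift T (g k) x))
     /\
     w_ae T (rho k.+1) (fun x =>
       a k * g k x *
         (B k x * tshiftV T (h k.+1) x ^+ 2 / (m x * tshiftV T m x)
          - (a k)^-1 * (phi k x ^+ 2 * eta k x / g k x))
       + b k
       = tshift T (B k) x * h k x ^+ 2 / (tshift T m x * m x)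
         - (a k)^-1 * (tshift T (phi k) x ^+ 2 * tshift T (eta k) x
                       / tshift T (g k) x)
           * (h k x ^+ 2 / h k.+1 x ^+ 2))).
Proof.
move=> m eta phi opA opA'.
have m_gt0 x : kappa T x -> 0 < m x by exact: graininess_gt0.
have adjoint_coef k psi x : fin_supp T psi -> kappa T x -> 0 < rho k.+1 x ->
    (opA k (opA' k psi) x
     = (a k)%:C * opA' k.+1 (opA k.+1 psi) x + (b k)%:C * psi x) <->
    ((coef_up T A B g h f (a k) k x)%:C * psi (sigma T x)
     + (coef_diag T A B g h f (a k) (b k) k x)%:C * psi x
     + (coef_down T B g h f (a k) k x)%:C * psi (sigmaV T x) = 0).
  move=> fin Kx pos.
  have <- := commutator_coef h f (a k) (b k) hT hrho hg fin Kx pos.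
  split=> [E|/eqP]; last by rewrite subr_eq0 => /eqP.
  by apply/eqP; rewrite subr_eq0; apply/eqP.
split=> [op k|rel k psi fin x Kx pos].
  have coef0 x : kappa T x -> 0 < rho k.+1 x ->
      [/\ coef_up T A B g h f (a k) k x = 0,
          coef_diag T A B g h f (a k) (b k) k x = 0
        & coef_down T B g h f (a k) k x = 0].
    move=> Kx pos; apply: (three_term_eq0 hT).
    - exact: (weight_succ_gt0_kappa2 hrho Kx pos).
    (* At the minimum of [kappa T] the truncated shifts make the lowest coefficient vanish. *)
    - move=> nkx; rewrite /coef_down /tshiftV !indicE (memNset nkx).
      by rewrite !mulr0 mul0r subr0 !mul0r.
    - by move=> psi fin; apply/adjoint_coef => //; exact: op.
  have up_rel x : kappa T x -> 0 < rho k.+1 x -> eta k (sigma T x) != 0 ->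
      a k * g k (sigma T x) * h k.+1 x * phi k.+1 x
      = h k x * phi k (sigma T x).
    move=> Kx pos eta0; have [/eqP + _ _] := coef0 _ Kx pos.
    rewrite /coef_up !mulf_eq0 invr_eq0 (negPf eta0) (gt_eqF (m_gt0 _ Kx)).
    by rewrite !orbF subr_eq0 => /eqP.
  split=> x Kx pos.
    have pos1 := weight_pred_gt0 hT hrho Kx pos.
    have KKx := weight_succ_gt0_kappa2 hrho Kx pos1.
    have Ks : kappa T (sigma T x) by apply/kappa2P.
    have g0 := g_neq0 k _ Ks.
    (* Otherwise rho_{k+2}(x), which is eta_k g_k at [sigma T x] times rho_{k+1}(x), would
       vanish. *)
    have eta0 : eta k (sigma T x) != 0.
      apply/eqP => eta0; move: pos.
      by rewrite (weight_mul hT hrho)// (eta_succ hT hrho hg Kx pos1)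
        [X in X * _ * _]eta0 !mul0r ltxx.
    have E := up_rel _ Kx pos1 eta0.
    rewrite /tshift !indicE (mem_set KKx) !mulr1 -E.
    by field; rewrite g0 a_neq0.
  have KKx := weight_succ_gt0_kappa2 hrho Kx pos.
  have Ks : kappa T (sigma T x) by apply/kappa2P.
  have [_ + _] := coef0 _ Kx pos.
  by case: (coef_diag_eq0 (b k) hT KKx (a_neq0 k) (g_neq0 k _ Kx)
    (g_neq0 k _ Ks) (h_neq0 k _ KKx) (up_rel _ Kx pos)) => + _; exact.
have KKx := weight_succ_gt0_kappa2 hrho Kx pos.
have Ks : kappa T (sigma T x) by apply/kappa2P.
have up_rel y : kappa T y -> 0 < rho k.+2 y ->
    a k * g k (sigma T y) * h k.+1 y * phi k.+1 y = h k y * phi k (sigma T y).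
  move=> Ky pos2.
  have KKy := weight_succ_gt0_kappa2 hrho Ky (weight_pred_gt0 hT hrho Ky pos2).
  have gs0 : g k (sigma T y) != 0 by apply: g_neq0; apply/kappa2P.
  have [/(_ _ Ky pos2) + _] := rel k.
  rewrite /tshift !indicE (mem_set KKy) !mulr1 => E.
  by rewrite -[LHS]mulrA E; field; rewrite gs0 a_neq0.
(* Since g_k has no zeros on [kappa T], a nonzero eta_k at [sigma T x] makes rho_{k+2}(x) positive,
   and the first relation applies. *)
have up_rel_x : eta k (sigma T x) != 0 ->
    a k * g k (sigma T x) * h k.+1 x * phi k.+1 x = h k x * phi k (sigma T x).
  move=> eta0; apply: (up_rel _ Kx); apply: (weight_gt0 hrho Kx).
  rewrite (weight_mul hT hrho)// (eta_succ hT hrho hg Kx pos).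
  by rewrite !mulf_neq0 ?(gt_eqF pos)//; exact: g_neq0.
apply/adjoint_coef => //.
have -> : coef_up T A B g h f (a k) k x = 0.
  rewrite /coef_up -[B k _ + _]/(eta k (sigma T x)).
  have [->|/up_rel_x ->] := eqVneq (eta k (sigma T x)) 0.
    by rewrite mulr0 mul0r.
  by rewrite subrr !mul0r.
have -> : coef_diag T A B g h f (a k) (b k) k x = 0.
  have [_ /(_ _ Kx pos)] := rel k.
  by case: (coef_diag_eq0 (b k) hT KKx (a_neq0 k) (g_neq0 k _ Kx)
    (g_neq0 k _ Ks) (h_neq0 k _ KKx) up_rel_x) => _ +; exact.
(* The last coefficient is trivially zero at the minimum of [kappa T] and where B_k(x) = 0.
   Elsewhere rho_{k+2} at [sigmaV T x] equals g_k B_k rho_{k+1} at x, which is nonzero. *)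
suff -> : coef_down T B g h f (a k) k x = 0 by rewrite !mul0r !addr0.
rewrite /coef_down /tshiftV !indicE.
have [kx|nkx] := pselect (kappam (kappa T) x); last first.
  by rewrite (memNset nkx) !mulr0 mul0r subr0 !mul0r.
have [KKy yx] := sigmaVP hT kx.
(* The first relation at sigma^-1 x. *)
have [->|B0] := eqVneq (B k x) 0; first by rewrite mulr0 mul0r.
have pos2 : 0 < rho k.+2 (sigmaV T x).
  apply: (weight_gt0 hrho); first exact: kappaK.
  rewrite (weight_sigma hrho)// yx hg; last exact: kappaT.
  by rewrite !mulf_neq0 ?(gt_eqF pos) ?g_neq0.
have := up_rel _ (kappaK KKy) pos2; rewrite yx (mem_set kx) !mulr1 => ->.
by rewrite [phi k x * _]mulrC subrr !mul0r.
Qed.
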